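(* Let $1<p<\infty$, let $q\ge 1$, let $T>0$, and let $X$ be a Banach space with smooth norm such that either $X$ is reflexive or $X^*$ is separable. Identify the dual space $[L^p(0,T;X)]^*$ with $L^{p^*}(0,T;X^* )$, where $\frac1p+\frac1{p^*}=1$. Then for $\vartheta\in L^p(0,T;X)$ (with $\vartheta\neq 0$ if $q<p$), the duality mapping $j_q^{L^p(0,T;X)}(\vartheta)\in L^{p^*}(0,T;X^* )$ is given by $$\left(j_q^{L^p(0,T;X)}\vartheta\right)(t)=\|\vartheta\|_{L^p(0,T;X)}^{\,q-p}\; j_p^X\big(\vartheta(t)\big),\qquad t\in[0,T].$$
   Context: For a normed space $Z$ and $q\ge1$, the (set-valued) duality mapping $J_q^Z:Z\rightrightarrows Z^*$ (with respect to $h\mapsto h^{q-1}$) is $J_q^Z(x)=\{x^*\in Z^*:\langle x,x^*\rangle=\|x\|\,\|x^*\|,\ \|x^*\|=\|x\|^{q-1}\}$; a single-valued selection is denoted $j_q^Z$. A Banach space $Z$ is smooth if for every $x\in Z\setminus\{0\}$ there is a unique $x^*\in Z^*$ with $\|x^*\|=1$ and $\langle x^*,x\rangle=\|x\|$; in that case $j_q^Z$ is unique. The Lebesgue-Bochner space $L^p(0,T;X)$ consists of (classes of) strongly measurable functions $\vartheta:[0,T]\to X$ with $\|\vartheta\|_{L^p(0,T;X)}=\left(\int_0^T\|\vartheta(t)\|_X^p\,dt\right)^{1/p}<\infty$. When $X$ is reflexive or $X^*$ is separable, $[L^p(0,T;X)]^*=L^{p^*}(0,T;X^* )$ via the pairing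 $\langle\psi^*,\psi\rangle=\int_0^T\langle\psi^*(t),\psi(t)\rangle_{X^*,X}\,dt$. Equalities of functions of $t$ are understood for almost every $t$. *)

(* Defs.v *)
From HB Require Import structures.
From mathcomp Require Import all_boot all_order all_algebra.
From mathcomp Require Import all_classical all_reals all_analysis.
From mathcomp Require Import measurable_realfun.

Set Implicit Arguments.
Unset Strict Implicit.
Unset Printing Implicit Defensive.

Import Order.TTheory GRing.Theory Num.Def Num.Theory.
Import numFieldNormedType.Exports.

Local Open Scope classical_set_scope.
Local Open Scope ring_scope.
Local Open Scope quotient_scope.

Section Dual.
Context {R : realType} (V : normedModType R).

Definition dual_pred : {pred V -> R^o} :=
  mem [set f : V -> R^o | linear f /\ continuous f].

Let dual_submod_closed : submod_closed dual_pred.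
Proof.
split.
  rewrite inE; split; first by move=> a x y; rewrite scaler0 addr0.
  exact: cst_continuous.
move=> a f g /[!inE] -[lf cf] [lg cg]; split.
  move=> k x y; rewrite !fctE lf lg !scalerDr !scalerA mulrC -!addrA; congr (_ + _).
  by rewrite addrCA.
by move=> x; apply: continuousD; [apply: continuousZl_tmp; exact: cf|exact: cg].
Qed.

HB.instance Definition _ := GRing.isSubmodClosed.Build _ _ dual_pred
  dual_submod_closed.

Record dual : Type := Dual { dual_fun :> V -> R^o ; _ : dual_fun \in dual_pred }.

HB.instance Definition _ := [isSub for dual_fun].
HB.instance Definition _ := [Choice of dual by <:].
HB.instance Definition _ := [SubChoice_isSubLmodule of dual by <:].

Implicit Types (f g : dual) (x : V).

Lemma dual_linear f : linear f.
Proof. by case: f => f /= /[!inE] -[]. Qed.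

Lemma dual_continuous f : continuous f.
Proof. by case: f => f /= /[!inE] -[]. Qed.

Lemma dualDE f g x : (f + g) x = f x + g x.
Proof. by []. Qed.

Lemma dualZE (a : R) f x : (a *: f) x = a * f x.
Proof. by []. Qed.

Lemma dual_eqP f g : (forall x, f x = g x) -> f = g.
Proof. by move=> fg; apply/val_inj/funext. Qed.

HB.instance Definition _ f :=
  @GRing.isLinear.Build R V R^o _ (dual_fun f) (dual_linear f).

(* Operator norm on the topological dual. *)
Definition dual_norm f : R := sup [set `|f x| | x in [set x : V | `|x| <= 1]].

Let dual_bounded f : exists2 M : R, 0 <= M & forall x, `|f x| <= M * `|x|.
Proof.
have /linear_bounded_continuous/linear_boundedP/pinfty_ex_gt0 :
  continuous (dual_fun f : {linear V -> R^o}) by exact: dual_continuous.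
by move=> [M M0 h]; exists M; [exact: ltW|].
Qed.

Let dual_ubound f :
  has_ubound [set `|f x| | x in [set x : V | `|x| <= 1]].
Proof.
have [M M0 hM] := dual_bounded f; exists M => _ [x /= x1 <-].
by rewrite (le_trans (hM x))// ler_piMr.
Qed.

Lemma dual_norm_ge0 f : 0 <= dual_norm f.
Proof.
apply: ub_le_sup; first exact: dual_ubound.
by exists 0; rewrite /= ?normr0// linear0 normr0.
Qed.

Lemma le_dual_norm f x : `|f x| <= dual_norm f * `|x|.
Proof.
have [->|x0] := eqVneq x 0; first by rewrite linear0 !normr0 mulr0.
rewrite -ler_pdivrMr ?normr_gt0//; apply: ub_le_sup; first exact: dual_ubound.
exists (`|x|^-1 *: x).
  by rewrite /= normrZ normfV normr_id mulVf ?normr_eq0.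
by rewrite linearZ /= normrM normfV normr_id mulrC.
Qed.

Lemma dual_norm_le f (M : R) :
  0 <= M -> (forall x, `|f x| <= M * `|x|) -> dual_norm f <= M.
Proof.
move=> M0 fM; apply: ge_sup.
  by exists `|f 0|, 0; rewrite //= normr0.
by move=> _ [x /= x1 <-]; rewrite (le_trans (fM x))// ler_piMr.
Qed.

Let dual_normD f g : dual_norm (f + g) <= dual_norm f + dual_norm g.
Proof.
apply: dual_norm_le => [|x]; first by rewrite addr_ge0 ?dual_norm_ge0.
by rewrite mulrDl (le_trans (ler_normD _ _))// lerD// le_dual_norm.
Qed.

Let dual_normZ_le (a : R) f : dual_norm (a *: f) <= `|a| * dual_norm f.
Proof.
apply: dual_norm_le => [|x]; first by rewrite mulr_ge0 ?dual_norm_ge0.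
by rewrite dualZE normrM -mulrA ler_wpM2l// le_dual_norm.
Qed.

Let dual_normZ (a : R) f : dual_norm (a *: f) = `|a| * dual_norm f.
Proof.
apply/eqP; rewrite eq_le dual_normZ_le /=.
have [->|a0] := eqVneq a 0; first by rewrite normr0 mul0r dual_norm_ge0.
rewrite -ler_pdivlMl ?normr_gt0// -normfV -[in leLHS](scalerK a0 f).
exact: dual_normZ_le.
Qed.

Let dual_norm0_eq0 f : dual_norm f = 0 -> f = 0.
Proof.
move=> f0; apply: dual_eqP => x; apply/eqP; rewrite -normr_le0.
by have := le_dual_norm f x; rewrite f0 mul0r.
Qed.

HB.instance Definition _ := @Lmodule_isNormed.Build R dual dual_norm
  dual_normD dual_normZ dual_norm0_eq0.

Lemma dual_normE f : `|f| = sup [set `|f x| | x in [set x : V | `|x| <= 1]].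
Proof. by []. Qed.

Lemma dual_norm_bound f x : `|f x| <= `|f| * `|x|.
Proof. exact: le_dual_norm. Qed.

End Dual.

Section DualityMapping.
Context {R : realType} (V : normedModType R).

(* The canonical embedding of V in its bidual is onto. *)
Definition reflexive_space :=
  forall F : dual (dual V), exists x : V, forall f : dual V, F f = f x.

Definition smooth_norm :=
  forall x : V, x != 0 -> exists! f : dual V, `|f| = 1 /\ f x = `|x|.

(* powR has 0 `^ 0 = 1, so that duality_mapping 1 0 is the unit sphere of the
   dual; for q > 1, duality_mapping q 0 = [set 0]. *)
Definition duality_mapping (q : R) (x : V) : set (dual V) :=
  [set f : dual V | f x = `|x| * `|f| /\ `|f| = `|x| `^ (q - 1)].

End DualityMapping.

Definition separable_space (T : topologicalType) :=
  exists2 D : set T, countable D & dense D.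

Section StrongMeasurability.
Context d (T : measurableType d) (R : realType).

Definition simple_fun (V : Type) (s : T -> V) :=
  finite_set (range s) /\ forall v, measurable (s @^-1` [set v]).

Lemma simple_fun_preimage (V : Type) (s : T -> V) (B : set V) :
  simple_fun s -> measurable (s @^-1` B).
Proof.
move=> [fs ms].
have -> : s @^-1` B = \bigcup_(v in range s `&` B) s @^-1` [set v].
  apply/seteqP; split=> [t Bst|t [v [_ Bv] /= ->//]].
  by exists (s t) => //; split => //; exists t.
apply: fin_bigcup_measurable => [|v _]; last exact: ms.
by apply: sub_finite_set fs => v [].
Qed.

Lemma simple_fun_comp (V W : Type) (h : V -> W) (s : T -> V) :
  simple_fun s -> simple_fun (h \o s).
Proof.
move=> ss; split; last by move=> w; rewrite comp_preimage; exact: simple_fun_preimage.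
have [fs _] := ss.
by apply: sub_finite_set (finite_image h fs) => _ [t _ <-]; exists (s t) => //; exists t.
Qed.

Lemma simple_fun_pair (V W : Type) (s : T -> V) (r : T -> W) :
  simple_fun s -> simple_fun r -> simple_fun (fun t => (s t, r t)).
Proof.
move=> [fs ms] [fr mr]; split.
  apply: sub_finite_set (finite_setX fs fr) => _ [t _ <-].
  by split; exists t.
move=> [v w].
have -> : (fun t => (s t, r t)) @^-1` [set (v, w)] =
    s @^-1` [set v] `&` r @^-1` [set w].
  by apply/seteqP; split=> t /= [-> ->].
exact: measurableI.
Qed.

Lemma simple_fun_comp2 (V1 V2 W : Type) (h : V1 -> V2 -> W) (s1 : T -> V1)
    (s2 : T -> V2) :
  simple_fun s1 -> simple_fun s2 -> simple_fun (fun t => h (s1 t) (s2 t)).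
Proof.
by move=> ss1 ss2; exact: (simple_fun_comp (uncurry h) (simple_fun_pair ss1 ss2)).
Qed.

Lemma simple_fun_measurable (s : T -> R) : simple_fun s -> measurable_fun setT s.
Proof. by move=> ss _ B mB; rewrite setTI; exact: simple_fun_preimage. Qed.

(* Pointwise limit, everywhere, of simple functions. A function which is only an
   almost everywhere limit of simple functions is equal almost everywhere to one
   of these, so that the spaces of classes modulo almost everywhere equality
   below are the usual ones. *)
Definition strongly_measurable (V : topologicalType) (f : T -> V) :=
  exists s : nat -> T -> V, (forall n, simple_fun (s n)) /\
    forall t, s ^~ t @ \oo --> f t.

Lemma strongly_measurable_cst (V : topologicalType) (v : V) :
  strongly_measurable (cst v).
Proof.
exists (fun=> cst v); split=> [_|t]; last exact: cvg_cst.
split; first exact: finite_image_cst.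
move=> w; rewrite preimage_cst; case: ifP => _; [exact: measurableT|exact: measurable0].
Qed.

Lemma strongly_measurable_measurable (f : T -> R) :
  strongly_measurable f -> measurable_fun setT f.
Proof.
move=> [s [ss sf]]; apply: (@measurable_fun_cvg _ _ _ _ s).
  by move=> m; exact: simple_fun_measurable.
by move=> t _; exact: sf.
Qed.

Context (V : normedModType R).
Implicit Types f g : T -> V.

Lemma strongly_measurableD f g :
  strongly_measurable f -> strongly_measurable g -> strongly_measurable (f + g).
Proof.
move=> [s [ss sf]] [r [sr rg]]; exists (fun n t => s n t + r n t); split=> [n|t].
  exact: simple_fun_comp2.
exact: cvgD.
Qed.

Lemma strongly_measurableZ (a : R) f :
  strongly_measurable f -> strongly_measurable (a *: f).
Proof.
move=> [s [ss sf]]; exists (fun n t => a *: s n t); split=> [n|t].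
  exact: (simple_fun_comp ( *:%R a)).
exact: cvgZl_tmp.
Qed.

Lemma strongly_measurable_norm f :
  strongly_measurable f -> measurable_fun setT (fun t => `|f t|).
Proof.
move=> [s [ss sf]]; apply: strongly_measurable_measurable.
exists (fun n t => `|s n t|); split=> [n|t].
  exact: (simple_fun_comp normr).
exact: cvg_norm.
Qed.

Lemma strongly_measurable_pairing (g : T -> dual V) f :
  strongly_measurable g -> strongly_measurable f ->
  measurable_fun setT (fun t => g t (f t) : R).
Proof.
move=> [r [sr rg]] [s [ss sf]]; apply: strongly_measurable_measurable.
exists (fun n t => r n t (s n t)); split=> [n|t].
  exact: (simple_fun_comp2 (fun (x : dual V) y => x y : R)).
have -> : (fun n => r n t (s n t)) =
    (fun n => g t (s n t) + (r n t - g t) (s n t)).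
  by apply/funext => n; rewrite dualDE addrC [(- g t) _]/(- (g t _)) subrK.
rewrite -[g t (f t)]addr0; apply: cvgD.
  by apply: continuous_cvg => //; exact: dual_continuous.
apply/norm_cvg0P.
have h : (fun n => `|r n t - g t| * `|s n t|) @ \oo --> 0 * `|f t|.
  apply: cvgM; last exact: cvg_norm.
  by rewrite -(@normr0 _ (dual V)) -(subrr (g t)); apply: cvg_norm; apply: cvgB => //; exact: cvg_cst.
rewrite mul0r in h.
apply: (squeeze_cvgr _ (cvg_cst 0) h).
near=> n; rewrite normr_ge0 /=. exact: (dual_norm_bound (r n t - g t)).
Unshelve. all: by end_near. Qed.

End StrongMeasurability.

Section BochnerFunctions.
Context d (T : measurableType d) (R : realType).
Variables (mu : {measure set T -> \bar R}) (p : R) (p1 : 1 <= p).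
Variable V : normedModType R.
Implicit Types f g : T -> V.

Let p0 : 0 < p. Proof. exact: lt_le_trans p1. Qed.

(* (\int `|f t| `^ p) `^ p^-1, possibly +oo *)
Definition Bochner_norm f : \bar R := 'N[mu]_p%:E [EFin \o (fun t => `|f t|)].

Let Bochner_norm_le f (g : T -> R) : strongly_measurable f ->
  measurable_fun setT g -> (forall t, `|f t| <= g t) ->
  (Bochner_norm f <= 'N[mu]_p%:E [EFin \o g])%E.
Proof.
move=> mf mg fg; rewrite /Bochner_norm unlock /Lnorm.
have ge0 (h : T -> R) : (0 <= \int[mu]_t (`|(EFin \o h) t| `^ p) <= +oo)%E.
  by rewrite leey andbT integral_ge0// => t _; exact: poweR_ge0.
apply: gt0_ler_poweR; rewrite ?invr_ge0 ?(ltW p0) ?in_itv //=; try exact: ge0.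
apply: ge0_le_integral => //=.
- apply/measurable_EFinP/(measurableT_comp (measurable_powR p)).
  exact/measurableT_comp/strongly_measurable_norm.
- apply/measurable_EFinP/(measurableT_comp (measurable_powR p)).
  exact: measurableT_comp.
- move=> t _; rewrite lee_fin ge0_ler_powR ?(ltW p0) ?nnegrE//.
  by rewrite normr_id (le_trans (fg t))// ler_norm.
Qed.

Lemma Bochner_normD f g : strongly_measurable f -> strongly_measurable g ->
  (Bochner_norm (f + g)%R <= Bochner_norm f + Bochner_norm g)%E.
Proof.
move=> mf mg.
have mf' := strongly_measurable_norm mf.
have mg' := strongly_measurable_norm mg.
apply: (@le_trans _ _ ('N[mu]_p%:E[EFin \o ((fun t => `|f t|) \+ (fun t => `|g t|))%R])%E).
  apply: Bochner_norm_le; first exact: strongly_measurableD.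
    exact: measurable_funD.
  by move=> t; exact: ler_normD.
exact: minkowski_EFin.
Qed.

(* The unused proof of 1 <= p lets the algebraic structures, which depend on it,
   be inferred from the type. *)
Definition Bochner_pred of 1 <= p : {pred T -> V} :=
  mem [set f | strongly_measurable f /\ (Bochner_norm f < +oo)%E].

Let Bochner_norm0 : Bochner_norm 0 = 0%E.
Proof.
rewrite /Bochner_norm.
have -> : EFin \o (fun t => `|(0 : T -> V) t|) = cst 0%E.
  by apply/funext => t /=; rewrite normr0.
by rewrite Lnorm0// eqe gt_eqF.
Qed.

Lemma Bochner_normZ (a : R) f : f \in Bochner_pred p1 ->
  Bochner_norm (a *: f)%R = (`|a|%:E * Bochner_norm f)%E.
Proof.
rewrite inE => -[mf nf].
have H : (fun t => `|f t|) \in Lfun mu p%:E.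
  by rewrite inE /=; apply/andP; split; rewrite inE //=; exact: strongly_measurable_norm.
have := LnormZ (Lfun_Sub (p1 : (1 <= p%:E)%E) H) `|a|.
rewrite normr_id => <-; congr Lnorm; apply/funext => t /=.
by rewrite normrZ.
Qed.

Let Bochner_submod_closed : submod_closed (Bochner_pred p1).
Proof.
split.
  rewrite inE; split; last by rewrite Bochner_norm0.
  exact: strongly_measurable_cst.
move=> a f g fP gP; have nZ := Bochner_normZ a fP.
move: fP gP; rewrite !inE => -[mf nf] [mg ng].
have maf := strongly_measurableZ a mf.
split; first exact: strongly_measurableD.
rewrite (le_lt_trans (Bochner_normD maf mg))// nZ lte_add_pinfty//.
by rewrite lte_mul_pinfty// lee_fin.
Qed.

HB.instance Definition _ := GRing.isSubmodClosed.Build _ _ (Bochner_pred p1)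
  Bochner_submod_closed.

Record Bochner_fun : Type :=
  BochnerFun { Bochner_val :> T -> V ; _ : Bochner_val \in Bochner_pred p1 }.

HB.instance Definition _ := [isSub for Bochner_val].
HB.instance Definition _ := [Choice of Bochner_fun by <:].
HB.instance Definition _ := [SubChoice_isSubLmodule of Bochner_fun by <:].

End BochnerFunctions.

Section BochnerSpace.
Context d (T : measurableType d) (R : realType).
Variables (mu : {measure set T -> \bar R}) (p : R) (p1 : 1 <= p).
Variable V : normedModType R.
Implicit Types f g : Bochner_fun mu p1 V.

Let p0 : 0 < p. Proof. exact: lt_le_trans p1. Qed.

Lemma Bochner_funDE f g t : (f + g) t = f t + g t.
Proof. by []. Qed.

Lemma Bochner_funBE f g t : (f - g) t = f t - g t.
Proof. by []. Qed.

Lemma Bochner_funZE (a : R) f t : (a *: f) t = a *: f t.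
Proof. by []. Qed.

Definition ae_zero_pred : {pred Bochner_fun mu p1 V} :=
  mem [set f : Bochner_fun mu p1 V | {ae mu, forall t, f t = 0}].

Let ae_zero_zmod_closed : zmod_closed ae_zero_pred.
Proof.
split; first by rewrite inE /=; exact: aeW.
move=> f g /[!inE] /= f0 g0; apply: filterS2 f0 g0 => t f0 g0 /=.
by change (f t - g t = 0); rewrite f0 g0 subrr.
Qed.

HB.instance Definition _ := GRing.isZmodClosed.Build _ ae_zero_pred
  ae_zero_zmod_closed.

(* The Lebesgue-Bochner space L^p(mu; V): p-integrable strongly measurable
   functions modulo almost everywhere equality. *)
Definition Bochner : Type := Quotient.quot ae_zero_pred.

HB.instance Definition _ := Choice.on Bochner.
HB.instance Definition _ := EqQuotient.on Bochner.
HB.instance Definition _ := GRing.Zmodule.on Bochner.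

Definition Bochner_repr (u : Bochner) : T -> V := Bochner_val (repr u).
Coercion Bochner_repr : Bochner >-> Funclass.

Definition Bochner_class f : Bochner := \pi f.
Implicit Types u v : Bochner.

Lemma Bochner_classP f g :
  (Bochner_class f = Bochner_class g) <-> {ae mu, forall t, f t = g t}.
Proof.
have -> : (Bochner_class f = Bochner_class g) <-> (f - g \in ae_zero_pred).
  by rewrite Quotient.idealrBE; split => /eqP.
rewrite inE; split; apply: filterS => t.
  by move=> /eqP; rewrite Bochner_funBE subr_eq0 => /eqP.
by move=> fg; apply/eqP; rewrite Bochner_funBE subr_eq0 fg.
Qed.

Lemma Bochner_classK u : Bochner_class (repr u) = u.
Proof. exact: reprK. Qed.

Lemma Bochner_reprK f : {ae mu, forall t, Bochner_class f t = f t}.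
Proof. by apply/Bochner_classP; rewrite Bochner_classK. Qed.

Lemma Bochner_eqP u v : u = v <-> {ae mu, forall t, u t = v t}.
Proof. by rewrite -Bochner_classP !Bochner_classK. Qed.

Lemma Bochner_classD f g :
  Bochner_class (f + g) = Bochner_class f + Bochner_class g.
Proof. exact: raddfD. Qed.

Lemma BochnerDE u v : {ae mu, forall t, (u + v : Bochner) t = u t + v t}.
Proof.
have -> : u + v = Bochner_class (repr u + repr v).
  by rewrite Bochner_classD !Bochner_classK.
exact: Bochner_reprK.
Qed.

Definition Bochner_scale (a : R) u : Bochner := Bochner_class (a *: repr u).

Let BochnerZE_subproof a u :
  {ae mu, forall t, Bochner_scale a u t = a *: u t}.
Proof. exact: Bochner_reprK. Qed.

Let scaleA (a b : R) u :
  Bochner_scale a (Bochner_scale b u) = Bochner_scale (a * b) u.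
Proof.
apply/Bochner_eqP.
apply: filterS3 (BochnerZE_subproof a (Bochner_scale b u))
  (BochnerZE_subproof b u) (BochnerZE_subproof (a * b) u) => t -> -> ->.
by rewrite scalerA.
Qed.

Let scale1 : left_id 1 Bochner_scale.
Proof.
move=> u; apply/Bochner_eqP.
by apply: filterS (BochnerZE_subproof 1 u) => t ->; rewrite scale1r.
Qed.

Let scaleDr : right_distributive Bochner_scale +%R.
Proof.
move=> a u v; apply/Bochner_eqP.
apply: filter_app (BochnerZE_subproof a (u + v)).
apply: filter_app (BochnerDE (Bochner_scale a u) (Bochner_scale a v)).
apply: filter_app (BochnerZE_subproof a u).
apply: filter_app (BochnerZE_subproof a v).
apply: filter_app (BochnerDE u v).
by apply: aeW => t -> -> -> -> ->; rewrite scalerDr.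
Qed.

Let scaleDl u : {morph Bochner_scale^~ u : a b / a + b}.
Proof.
move=> a b; apply/Bochner_eqP.
apply: filter_app (BochnerZE_subproof (a + b) u).
apply: filter_app (BochnerDE (Bochner_scale a u) (Bochner_scale b u)).
apply: filter_app (BochnerZE_subproof a u).
apply: filter_app (BochnerZE_subproof b u).
by apply: aeW => t -> -> -> ->; rewrite scalerDl.
Qed.

HB.instance Definition _ := GRing.Zmodule_isLmodule.Build R Bochner
  scaleA scale1 scaleDr scaleDl.

Lemma BochnerZE (a : R) u : {ae mu, forall t, (a *: u : Bochner) t = a *: u t}.
Proof. exact: BochnerZE_subproof. Qed.

Lemma Bochner0E : {ae mu, forall t, (0 : Bochner) t = 0}.
Proof.
have -> : (0 : Bochner) = Bochner_class 0 by exact/esym/raddf0.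
exact: Bochner_reprK.
Qed.

Lemma Bochner_strongly_measurable u : strongly_measurable u.
Proof. by have := valP (repr u); rewrite inE => -[]. Qed.

Lemma Bochner_norm_lty u : (Bochner_norm mu p u < +oo)%E.
Proof. by have := valP (repr u); rewrite inE => -[]. Qed.

Lemma Bochner_norm_fin_num u : Bochner_norm mu p u \is a fin_num.
Proof. by rewrite ge0_fin_numE ?Lnorm_ge0// Bochner_norm_lty. Qed.

Lemma ae_eq_Bochner_norm (f g : T -> V) :
  strongly_measurable f -> strongly_measurable g ->
  {ae mu, forall t, f t = g t} -> Bochner_norm mu p f = Bochner_norm mu p g.
Proof.
move=> mf mg fg; rewrite /Bochner_norm unlock /Lnorm; congr (_ `^ _)%E.
have mh (h : T -> V) : strongly_measurable h ->
    measurable_fun setT (fun t => (`|(EFin \o (fun t => `|h t|%R)) t| `^ p)%E).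
  move=> mh; apply: (measurableT_comp (measurable_poweR p)).
  apply: measurableT_comp => //.
  exact/measurable_EFinP/strongly_measurable_norm.
apply: ae_eq_integral => //; [exact: mh|exact: mh|].
by apply: filterS fg => t fg _; rewrite /= fg.
Qed.

Definition Bochner_space_norm u : R := fine (Bochner_norm mu p u).

Let normD u v :
  Bochner_space_norm (u + v) <= Bochner_space_norm u + Bochner_space_norm v.
Proof.
have mu_ := Bochner_strongly_measurable u.
have mv_ := Bochner_strongly_measurable v.
rewrite -fineD ?Bochner_norm_fin_num//; apply: fine_le.
- exact: Bochner_norm_fin_num.
- by rewrite fin_numD !Bochner_norm_fin_num.
rewrite (@ae_eq_Bochner_norm (u + v : Bochner) ((u : T -> V) + v)).
- exact: Bochner_normD.
- exact: Bochner_strongly_measurable.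
- exact: strongly_measurableD.
- exact: BochnerDE.
Qed.

Let normZ (a : R) u :
  Bochner_space_norm (a *: u) = `|a| * Bochner_space_norm u.
Proof.
have mu_ := Bochner_strongly_measurable u.
rewrite /Bochner_space_norm.
rewrite (@ae_eq_Bochner_norm (a *: u : Bochner) (a *: (u : T -> V))).
- by rewrite (Bochner_normZ _ (valP (repr u))) fineM// Bochner_norm_fin_num.
- exact: Bochner_strongly_measurable.
- exact: strongly_measurableZ.
- exact: BochnerZE.
Qed.

Let norm0_eq0 u : Bochner_space_norm u = 0 -> u = 0.
Proof.
move=> /eqP; rewrite /Bochner_space_norm fine_eq0 ?Bochner_norm_fin_num// => /eqP.
have mu_ : measurable_fun setT (EFin \o (fun t => `|u t|)).
  exact/measurable_EFinP/strongly_measurable_norm/Bochner_strongly_measurable.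
move=> /(Lnorm_eq0_eq0 mu_); rewrite lte_fin => /(_ p0) u0.
apply/Bochner_eqP; apply: filter_app Bochner0E; apply: filterS u0 => t.
by move=> /(_ I)[] /eqP; rewrite normr_eq0 => /eqP -> ->.
Qed.

HB.instance Definition _ := @Lmodule_isNormed.Build R Bochner Bochner_space_norm
  normD normZ norm0_eq0.

Lemma Bochner_space_normE u : `|u| = fine (Bochner_norm mu p u).
Proof. by []. Qed.

End BochnerSpace.

Section BochnerPairing.
Context d (T : measurableType d) (R : realType).
Variables (mu : {measure set T -> \bar R}) (p p' : R).
Variables (p1 : 1 <= p) (p'1 : 1 <= p') (pp' : p^-1 + p'^-1 = 1).
Variable V : normedModType R.
Implicit Types (u v : Bochner mu p1 V).

Variable g : Bochner mu p'1 (dual V).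

Let pairing u : R := \int[mu]_t (g t (u t) : R).

Let measurable_pairing u : measurable_fun setT (fun t => g t (u t) : R).
Proof. by apply: strongly_measurable_pairing; exact: Bochner_strongly_measurable. Qed.

Let pairing_hoelder u :
  (\int[mu]_t (`|g t (u t) : R|%:E) <= (`|g| * `|u|)%:E)%E.
Proof.
rewrite EFinM !Bochner_space_normE !fineK ?Bochner_norm_fin_num//.
have mg := strongly_measurable_norm (Bochner_strongly_measurable g).
have mu_ := strongly_measurable_norm (Bochner_strongly_measurable u).
have := @hoelder _ _ _ mu _ _ p' p mg mu_ (lt_le_trans ltr01 p'1)
  (lt_le_trans ltr01 p1).
rewrite addrC => /(_ pp'); apply: le_trans; rewrite Lnorm1.
apply: ge0_le_integral => //.
- exact/measurable_EFinP/measurableT_comp.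
- apply: measurableT_comp => //; apply/measurable_EFinP; exact: measurable_funM.
- by move=> t _; rewrite /= lee_fin (le_trans (dual_norm_bound _ _))// ler_norm.
Qed.

Lemma integrable_pairing u : mu.-integrable setT (EFin \o (fun t => g t (u t) : R)).
Proof.
apply/integrableP; split; first exact/measurable_EFinP.
by apply: le_lt_trans (pairing_hoelder u) _; rewrite ltry.
Qed.

Let pairing_linear : linear (pairing : Bochner mu p1 V -> R^o).
Proof.
suff pairingD (a : R) u v :
    pairing (a *: u + v : Bochner mu p1 V) = a * pairing u + pairing v.
  exact: pairingD.
rewrite /pairing -RintegralZl//; last exact: integrable_pairing.
have iau : mu.-integrable setT (EFin \o (fun t => a * (g t (u t) : R))).
  exact: (integrableZl measurableT a (integrable_pairing u)).
rewrite -RintegralD//; last exact: integrable_pairing.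
rewrite /Rintegral; congr fine; apply: ae_eq_integral => //.
- exact/measurable_EFinP.
- apply/measurable_EFinP/measurable_funD => //.
  exact: measurable_funM.
apply: filter_app (BochnerDE (a *: u) v); apply: filterS (BochnerZE a u) => t e1 e2 _.
by rewrite e2 e1 linearD linearZ.
Qed.

Let pairing_continuous : continuous (pairing : Bochner mu p1 V -> R^o).
Proof.
pose F : {linear Bochner mu p1 V -> R^o} :=
  HB.pack pairing (@GRing.isLinear.Build _ _ _ _ _ pairing_linear).
apply: (@bounded_linear_continuous _ _ _ F); apply/linear_boundedP.
exists `|g|; split; first exact: normr_real.
move=> r gr u.
apply: (@le_trans _ _ (`|g| * `|u|)); last by rewrite ler_wpM2r// ltW.
rewrite -lee_fin /= EFin_normr_Rintegral//; last exact: integrable_pairing.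
apply: le_trans (pairing_hoelder u).
apply: le_trans (le_abse_integral _ _ _) _ => //.
exact/measurable_EFinP.
Qed.

(* The element of the dual of L^p(mu; V) identified with g in
   L^p'(mu; dual V). *)
Definition Bochner_pairing : dual (Bochner mu p1 V) :=
  Dual (mem_set (conj pairing_linear pairing_continuous)).

Lemma Bochner_pairingE u : Bochner_pairing u = \int[mu]_t (g t (u t) : R).
Proof. by []. Qed.

End BochnerPairing.

Arguments Bochner_pairing {d T R mu p p' p1 p'1} pp' {V} g.

Lemma conjugate_exponent_ge1 (R : realType) (p p' : R) :
  1 < p -> p^-1 + p'^-1 = 1 -> 1 <= p'.
Proof.
move=> p1 pp'; have p0 := lt_trans ltr01 p1.
have e : p'^-1 = 1 - p^-1 by rewrite -pp' addrAC subrr add0r.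
have i0 : 0 < p'^-1 by rewrite e subr_gt0 invf_lt1.
rewrite -[p']invrK invf_ge1// e gerBl invr_ge0 ltW//.
Qed.

(* Lebesgue measure restricted to [0, T]; almost everywhere equality and integrals
   ignore what happens outside [0, T]. *)
Definition lebesgue_on (R : realType) (T : R) :
    {measure set (measurableTypeR R) -> \bar R} :=
  mrestr lebesgue_measure (measurable_itv `[0, T]).

(* Main.v *)
(** The norm of a smooth space is Gateaux differentiable away from 0, its
    derivative being the support functional: the functional that Hahn-Banach puts
    below the one-sided derivative, with equality in a given direction, is a
    support functional, and there is only one. Hence [`|.| `^ p] has derivative
    [p * j_p x] at every [x]; by dominated convergence, the p-th power of the norm
    of L^p(0,T;X) then has derivative [p * <j_p o theta, .>] at [theta]. An element
    of the duality mapping of L^p(0,T;X) is a subgradient of this differentiable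
    function, so it equals this derivative: the description of the dual of
    L^p(0,T;X) is not needed.

    Reflexivity of X or separability of its dual makes [j_p o theta] strongly
    measurable. It is weak-* measurable, as a limit of difference quotients. If X is
    reflexive, its range lies in the closed span of countably many [j_p (x_n)], by
    Hahn-Banach in the dual, since a vector annihilating all the [j_p (x_n)] is
    annihilated by [j_p x] for every limit [x] of the [x_n]. *)

Require Import Defs.
From HB Require Import structures.
From mathcomp Require Import all_boot all_order all_algebra.
From mathcomp Require Import all_classical all_reals all_analysis.
From mathcomp Require Import measurable_realfun lra ring.

Set Implicit Arguments.
Unset Strict Implicit.
Unset Printing Implicit Defensive.

Import Order.TTheory GRing.Theory Num.Theory.
Import numFieldNormedType.Exports.

Local Open Scope classical_set_scope.
Local Open Scope ring_scope.

(** * Hahn-Banach theorem *)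

Section Sublinear.
Context {R : realType}.

(** For positive factors one inequality suffices: the inverse factor gives the reverse one. *)
Definition sublinear (V : lmodType R) (p : V -> R) :=
  (forall x y, p (x + y) <= p x + p y) /\
  (forall (a : R) x, 0 < a -> p (a *: x) <= a * p x).

Lemma ge_inf_range (I : Type) (F : I -> R) (i : I) :
  has_lbound (range F) -> inf (range F) <= F i.
Proof. by move=> bF; apply: ge_inf => //; exists i. Qed.

Lemma lb_le_inf_range (I : Type) (i0 : I) (F : I -> R) (b : R) :
  (forall i, b <= F i) -> b <= inf (range F).
Proof.
by move=> bF; apply: lb_le_inf; [exists (F i0), i0|move=> _ [i _ <-]].
Qed.

Context (V : lmodType R).
Implicit Types (p q : V -> R) (x y : V).

(** Serves for four infima: the modification along a direction, lower bounds of chains, the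
    one-sided derivative of the norm, and the distance to a span. *)
Lemma sublinear_inf (I : Type) (i0 : I) (F : I -> V -> R) :
  (forall x, has_lbound (range (F^~ x))) ->
  (forall i j x y, exists k, F k (x + y) <= F i x + F j y) ->
  (forall i (a : R) x, 0 < a -> exists k, F k (a *: x) <= a * F i x) ->
  sublinear (fun x => inf (range (F^~ x))).
Proof.
move=> bF FD FZ; split=> [x y|a x a0].
  rewrite /= -lerBlDr; apply: (lb_le_inf_range i0) => i.
  rewrite lerBlDr [leRHS]addrC -lerBlDr; apply: (lb_le_inf_range i0) => j.
  have [k Fk] := FD i j x y.
  by rewrite lerBlDr [leRHS]addrC; apply: le_trans Fk; exact: ge_inf_range.
rewrite /= -ler_pdivrMl//; apply: (lb_le_inf_range i0) => i.
have [k Fk] := FZ i a x a0.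
by rewrite ler_pdivrMl//; apply: le_trans Fk; exact: ge_inf_range.
Qed.

Lemma sublinear0 p : sublinear p -> p 0 = 0.
Proof.
move=> [pD pZ]; apply/le_anti/andP; split; last first.
  by have := pD 0 0; rewrite addr0 lerDl.
have := pZ 2^-1 0; rewrite scaler0 invr_gt0 ltr0n => /(_ isT); lra.
Qed.

Lemma sublinear_geN p x : sublinear p -> - p (- x) <= p x.
Proof.
move=> sp; have [pD _] := sp.
by have := pD x (- x); rewrite subrr (sublinear0 sp); lra.
Qed.

(** Take the infimum over [t >= 0] of [p (x + t *: y) - t * p y]: [t = 0] gives [q <= p], and
    [t = 1] at the point [- y] gives the last bound. *)
Lemma sublinear_direction p y : sublinear p ->
  exists q, [/\ sublinear q, forall x, q x <= p x & q (- y) <= - p y].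
Proof.
move=> sp; have [pD pZ] := sp.
have pZ' a x : 0 <= a -> p (a *: x) <= a * p x.
  rewrite le_eqVlt => /orP[/eqP <-|]; last exact: pZ.
  by rewrite scale0r mul0r sublinear0.
pose F (t : {t : R | 0 <= t}) x := p (x + sval t *: y) - sval t * p y.
have t0 : {t : R | 0 <= t} by exists 0.
have bF x : has_lbound (range (F^~ x)).
  exists (- p (- x)) => _ [[t t0'] _ <-]; rewrite /F/=.
  have := pD (x + t *: y) (- x); rewrite addrAC subrr add0r.
  have [->|t1] := eqVneq t 0.
    rewrite scale0r addr0 mul0r subr0; rewrite (sublinear0 sp) => ?; lra.
  have tp : 0 < t by rewrite lt_neqAle eq_sym t1.
  (* Homogeneity with factor [t^-1] gives [t * p y <= p (t *: y)], whence the lower bound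
     [- p (- x)]. *)
  have := pZ t^-1 (t *: y); rewrite scalerA mulVf// scale1r invr_gt0 => /(_ tp).
  rewrite mulrC ler_pdivlMr// => ? ?; lra.
exists (fun x => inf (range (F^~ x))); split.
- apply: (sublinear_inf t0) => // [[s s0] [t t0'] x1 x2|[s s0] a x a0].
    exists (exist _ (s + t) (addr_ge0 s0 t0')); rewrite /F/=.
    rewrite scalerDl addrACA.
    have := pD (x1 + s *: y) (x2 + t *: y); lra.
  exists (exist _ (a * s) (mulr_ge0 (ltW a0) s0)); rewrite /F/=.
  rewrite -scalerA -scalerDr mulrBr mulrA lerB// pZ//.
- move=> x; have := @ge_inf_range _ (F^~ x) (exist _ 0 (lexx 0)) (bF x).
  by rewrite /F/= scale0r addr0 mul0r subr0.
- have := @ge_inf_range _ (F^~ (- y)) (exist _ 1 ler01) (bF _).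
  by rewrite /F/= scale1r addNr sublinear0// mul1r sub0r.
Qed.

(** Zorn's lemma for the reversed pointwise order. The infimum of a chain is subadditive because the
    smaller of two members serves for both. *)
Lemma minimal_sublinear p : sublinear p ->
  exists q, [/\ sublinear q, forall x, q x <= p x &
    forall r, sublinear r -> (forall x, r x <= q x) -> r = q].
Proof.
move=> sp.
pose T := {q : V -> R | sublinear q /\ forall x, q x <= p x}.
pose Rel (q r : T) := `[< forall x, sval r x <= sval q x >].
have [||||[q [sq qp]] qmin] := @Zorn T Rel.
- by move=> q; apply/asboolP.
- move=> q r s /asboolP qr /asboolP rs; apply/asboolP => x.
  exact: le_trans (qr x).
- move=> [q Hq] [r Hr] /asboolP/= qr /asboolP/= rq; apply: eq_exist.
  by apply/funext => x; apply/le_anti; rewrite rq qr.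
- move=> A totA; have [[q0 Aq0]|A0] := pselect (exists q : T, A q); last first.
    exists (exist _ p (conj sp (fun=> lexx _))) => q Aq.
    by exfalso; apply: A0; exists q.
  pose F (q : {q : T | A q}) x := sval (sval q) x.
  have bF x : has_lbound (range (F^~ x)).
    exists (- p (- x)) => _ [[[q [sq qp]] Aq] _ <-]; rewrite /F/=.
    by apply: le_trans (sublinear_geN _ sq); rewrite lerN2.
  pose i0 : {q : T | A q} := exist _ q0 Aq0.
  have sF : sublinear (fun x => inf (range (F^~ x))).
    apply: (sublinear_inf i0) => // [[q Aq] [r Ar] x y|q a x a0].
      have [/asboolP rq|/asboolP qr] := totA _ _ Aq Ar.
        exists (exist _ r Ar); rewrite /F/=; have [[+ _] _] := svalP r.
        by move=> /(_ x y) h; rewrite (le_trans h)// lerD2r rq.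
      exists (exist _ q Aq); rewrite /F/=; have [[+ _] _] := svalP q.
      by move=> /(_ x y) h; rewrite (le_trans h)// lerD2l qr.
    by exists q; rewrite /F; have [[_ h] _] := svalP (sval q); exact: h.
  have Fp x : inf (range (F^~ x)) <= p x.
    apply: le_trans (ge_inf_range i0 (bF x)) _.
    by rewrite /F; have [_ h] := svalP (sval i0); exact: h.
  exists (exist (fun q => sublinear q /\ forall x, q x <= p x) _ (conj sF Fp)).
  move=> q Aq; apply/asboolP => x /=.
  exact: (@ge_inf_range _ (F^~ x) (exist _ q Aq)).
exists q; split => // r sr rq.
have rp x : r x <= p x by exact: le_trans (qp x).
have := qmin (exist _ r (conj sr rp)).
by move=> /(_ (asboolT rq)) [].
Qed.

Lemma sublinear_odd_linear q : sublinear q -> (forall x, q (- x) = - q x) ->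
  linear (q : V -> R^o).
Proof.
move=> [qD qZ] qN.
have qE x y : q (x + y) = q x + q y.
  apply/le_anti; rewrite qD/=.
  by have := qD (- x) (- y); rewrite -opprD !qN; lra.
have qZp a x : 0 < a -> q (a *: x) = a * q x.
  move=> a0; apply/le_anti; rewrite qZ//=.
  by have := qZ a (- x) a0; rewrite scalerN !qN; lra.
suff qZE a x : q (a *: x) = a * q x by move=> a x y; rewrite qE qZE.
have [a0|a0|->] := ltgtP a 0.
- apply: oppr_inj; rewrite -qN -scaleNr qZp ?oppr_gt0//; ring.
- exact: qZp.
- by rewrite scale0r mul0r; have := qN 0; rewrite oppr0; lra.
Qed.

(* A minimal sublinear functional below [p] is odd, by [sublinear_direction],
   hence linear. *)
Theorem sublinear_hahn_banach p y : sublinear p ->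
  exists f : V -> R, [/\ linear (f : V -> R^o), forall x, f x <= p x & f y = p y].
Proof.
move=> sp; have [q [sq qp qy]] := sublinear_direction y sp.
have [f [sf fq fmin]] := minimal_sublinear sq.
have fN x : f (- x) = - f x.
  have [r [sr rf rx]] := sublinear_direction x sf.
  rewrite (fmin _ sr rf) in rx.
  by apply/le_anti; rewrite rx/= lerNl; have := sublinear_geN x sf; lra.
exists f; split; first exact: sublinear_odd_linear.
  by move=> x; rewrite (le_trans (fq _)).
apply/le_anti; rewrite (le_trans (fq _))//=.
by have := fq (- y); rewrite fN; lra.
Qed.

End Sublinear.

(** Domination by the norm makes the functional continuous. Applied to the one-sided derivative of
    the norm, to the norm itself and to the distance to a span. *)
Lemma dual_hahn_banach (R : realType) (V : normedModType R) (p : V -> R) (y : V) :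
  sublinear p -> (forall x, p x <= `|x|) ->
  exists f : dual V, [/\ forall x, f x <= p x, f y = p y & `|f| <= 1].
Proof.
move=> sp p1; have [f [lf fp fy]] := sublinear_hahn_banach y sp.
pose F : {linear V -> R^o} := HB.pack f (@GRing.isLinear.Build _ _ _ _ _ lf).
have f1 x : `|f x| <= `|x|.
  rewrite ler_norml (le_trans (fp _))// andbT lerNl.
  have -> : - f x = f (- x) by rewrite -[f]/(F : _ -> _) linearN.
  by rewrite (le_trans (fp _))// -(normrN x).
have cf : continuous (f : V -> R^o).
  apply: (@bounded_linear_continuous _ _ _ F); apply/linear_boundedP.
  exists 1; split; first exact: real1.
  move=> r r1 x; apply: (le_trans (f1 x)); rewrite ler_peMl// ltW//.
exists (Dual (mem_set (conj lf cf))); split => //=.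
by apply: dual_norm_le => //= x; rewrite mul1r.
Qed.

(** * Differentiability of the norm and the duality mapping *)

Section NormDerivative.
Context {R : realType} (V : normedModType R).
Implicit Types (x y : V) (s t : R).

(** Convexity of the norm: [x + s *: y] is a convex combination of [x] and [x + t *: y], with weight
    [s / t] on the latter. *)
Lemma norm_quotient_nondecreasing x y s t : 0 < s -> s <= t ->
  (`|x + s *: y| - `|x|) / s <= (`|x + t *: y| - `|x|) / t.
Proof.
move=> s0 st; have t0 := lt_le_trans s0 st.
have st0 : 0 <= s / t by rewrite divr_ge0 ?ltW.
have st1 : s / t <= 1 by rewrite ler_pdivrMr// mul1r.
have -> : x + s *: y = (1 - s / t) *: x + (s / t) *: (x + t *: y).
  rewrite scalerDr scalerA divfK ?gt_eqF// addrA -scalerDl subrK scale1r//.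
rewrite ler_pdivrMr// -mulrA [t^-1 * s]mulrC.
have := ler_normD ((1 - s / t) *: x) ((s / t) *: (x + t *: y)).
rewrite (normrZ _ x) (normrZ _ (x + t *: y)) (ger0_norm st0) ger0_norm ?subr_ge0//.
lra.
Qed.

Lemma norm_quotient_ge (f : dual V) x y s : `|f| <= 1 -> f x = `|x| -> 0 < s ->
  f y <= (`|x + s *: y| - `|x|) / s.
Proof.
move=> f1 fx s0; rewrite ler_pdivlMr// lerBrDl mulrC -fx.
have -> : f x + s * f y = f (x + s *: y) by rewrite linearD linearZ.
rewrite (le_trans (ler_norm _))// (le_trans (dual_norm_bound _ _))//.
exact: ler_piMl.
Qed.

(** As the quotients are monotone, their infimum is the one-sided derivative of the norm at [x]. *)
Lemma sublinear_norm_derivative x :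
  sublinear (fun y => inf (range (fun s : {s : R | 0 < s} =>
    (`|x + sval s *: y| - `|x|) / sval s))).
Proof.
apply: (sublinear_inf (exist _ 1 ltr01 : {s : R | 0 < s})
  (F := fun (s : {s : R | 0 < s}) y => (`|x + sval s *: y| - `|x|) / sval s)).
- move=> y; exists (- `|y|) => _ [[s s0] _ <-] /=.
  rewrite ler_pdivlMr// lerBrDl mulNr -[_ * s]mulrC -[s in s * _]gtr0_norm//.
  by rewrite -normrZ lerBlDr -{1}[x](addrK (s *: y)) ler_normB.
- move=> [s s0] [t t0] y z; have st0 : 0 < s + t by exact: addr_gt0.
  (* With this step, [x + r *: (y + z)] is the convex combination of [x + s *: y] and [x + t *: z]
     with weights [r / s] and [r / t]. *)
  have r0 : 0 < s * t / (s + t) by rewrite divr_gt0// mulr_gt0.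
  exists (exist _ (s * t / (s + t)) r0) => /=; set r := s * t / (s + t).
  have rs : r / s <= 1.
    by rewrite /r mulrAC ler_pdivrMr// mul1r mulrAC divff ?gt_eqF// mul1r; lra.
  have rst : r / s + r / t = 1 by rewrite /r; field; lra.
  have -> : x + r *: (y + z) = (r / s) *: (x + s *: y) + (r / t) *: (x + t *: z).
    rewrite !scalerDr !scalerA !divfK ?gt_eqF// addrACA -scalerDl rst scale1r//.
  rewrite ler_pdivrMr//.
  have := ler_normD ((r / s) *: (x + s *: y)) ((r / t) *: (x + t *: z)).
  have rs0 : 0 < r / s by rewrite divr_gt0.
  have rt0 : 0 < r / t by rewrite divr_gt0.
  rewrite (normrZ _ (x + s *: y)) (normrZ _ (x + t *: z)).
  rewrite (gtr0_norm rs0) (gtr0_norm rt0) => h.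
  have -> : ((`|x + s *: y| - `|x|) / s + (`|x + t *: z| - `|x|) / t) * r =
    r / s * `|x + s *: y| + r / t * `|x + t *: z| - (r / s + r / t) * `|x|.
    by field; lra.
  by rewrite rst mul1r lerD2r.
- move=> [s s0] a y a0; exists (exist _ (s / a) (divr_gt0 s0 a0)) => /=.
  by rewrite scalerA divfK ?gt_eqF// invf_div mulrCA.
Qed.

Hypothesis smoothV : smooth_norm V.

(* The linear functional supplied by Hahn-Banach below the one-sided derivative
   of the norm, with equality at [y], is a support functional at [x], hence is
   [f] by smoothness. *)
Lemma smooth_norm_derivative (f : dual V) x y : x != 0 -> `|f| = 1 -> f x = `|x| ->
  (fun n => (`|x + harmonic n *: y| - `|x|) / harmonic n) @ \oo --> f y.
Proof.
move=> x0 f1 fx.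
pose D (z : V) (s : {s : R | 0 < s}) := (`|x + sval s *: z| - `|x|) / sval s.
have bD z : has_lbound (range (D z)).
  exists (f z) => _ [[s s0] _ <-].
  by apply: norm_quotient_ge => //; rewrite f1.
have D1 z : inf (range (D z)) <= `|x + z| - `|x|.
  have := ge_inf_range (exist _ 1 ltr01 : {s : R | 0 < s}) (bD z).
  by rewrite /D/= scale1r divr1.
have DV z : inf (range (D z)) <= `|z|.
  by apply: le_trans (D1 z) _; rewrite lerBlDl ler_normD.
have [g [gD gy g1]] := dual_hahn_banach y (sublinear_norm_derivative x) DV.
(* The lower bound comes from the direction [- x], where the quotient for step 1 is minus the norm
   of [x]. *)
have gx : g x = `|x|.
  apply/le_anti/andP; split; first exact: le_trans (DV x).
  have := le_trans (gD (- x)) (D1 (- x)).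
  by rewrite subrr normr0 sub0r linearN lerN2.
have gn1 : `|g| = 1.
  apply/le_anti; rewrite g1/=.
  have := dual_norm_bound g x; rewrite gx normr_id.
  by rewrite -[leLHS]mul1r ler_pM2r ?normr_gt0.
have [h [_ hU]] := smoothV x0.
have gf : g = f by rewrite -(hU g (conj gn1 gx)) (hU f (conj f1 fx)).
rewrite gf in gy.
apply/cvgrPdist_lt => e e0.
(* The infimum of the quotients is [f y]; a step [s] that nearly attains it controls all smaller
   steps by monotonicity. *)
have [|_ [[s s0] _ <-]] := @inf_adherent _ (range (D y)) e e0.
  by split => //; exists (D y (exist _ 1 ltr01)); exists (exist _ 1 ltr01).
rewrite -[inf _]gy /D/= => De.
near=> n.
have ns : harmonic n <= s by near: n; exact: cvgr_le (cvg_harmonic) _ s0.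
have := @norm_quotient_ge f x y (harmonic n) _ fx (harmonic_gt0 _).
rewrite f1 => /(_ (lexx _)) fn.
have := norm_quotient_nondecreasing x y (harmonic_gt0 n) ns.
rewrite distrC ger0_norm ?subr_ge0//; move: fn De; set u := (_ / harmonic n).
lra.
Unshelve. all: by end_near. Qed.

End NormDerivative.

(** This is Young's inequality for [b] and the power [p - 1] of [a], with conjugate exponents [p]
    and [p / (p - 1)]. *)
Lemma powR_tangent (R : realType) (p a b : R) : 1 < p -> 0 <= a -> 0 <= b ->
  p * a `^ (p - 1) * (b - a) <= b `^ p - a `^ p.
Proof.
move=> p1 a0 b0; have p0 : 0 < p by rewrite (lt_trans ltr01).
have p10 : 0 < p - 1 by rewrite subr_gt0.
have := @conjugate_powR R b (a `^ (p - 1)) p (p / (p - 1)) b0 (powR_ge0 _ _) p0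
  (divr_gt0 p0 p10).
have -> : p^-1 + (p / (p - 1))^-1 = 1 by field; lra.
move=> /(_ erefl); rewrite -powRrM mulrCA divff ?gt_eqF// mulr1 invf_div.
rewrite -(ler_pM2l p0).
have -> : p * (b `^ p / p + a `^ p * ((p - 1) / p)) = b `^ p + (p - 1) * a `^ p.
  by field; lra.
rewrite mulrBr -mulrA [_ * b]mulrC -mulrA [_ * a]mulrC mulr_powRB1//; lra.
Qed.

(** The power is differentiable at a positive limit; the limit 0 is treated directly, with the
    [r]-th root of [e] as threshold. *)
Lemma cvg_powR (R : realType) (r a : R) (u : nat -> R) : 0 < r ->
  (forall n, 0 <= u n) -> u @ \oo --> a -> (fun n => u n `^ r) @ \oo --> a `^ r.
Proof.
move=> r0 u0 ua.
have : 0 <= a by apply: (cvgr_to_ge ua); exact: nearW.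
rewrite le_eqVlt => /orP[/eqP a0|a0]; last first.
  have ca : {for a, continuous (@powR R ^~ r)}.
    apply: differentiable_continuous; apply/derivable1_diffP.
    by apply: derivable_powR; rewrite in_itv/= a0.
  exact: (cvg_comp u (@powR R ^~ r) ua ca).
rewrite -a0 powR0 ?gt_eqF// in ua *.
apply/cvgrPdist_lt => e e0; near=> n.
have un : u n < e `^ r^-1.
  by near: n; apply: cvgr_lt ua _ _; exact: powR_gt0.
rewrite sub0r normrN ger0_norm ?powR_ge0//.
rewrite -[ltRHS](powRr1 (ltW e0)) -(mulVf (lt0r_neq0 r0)) powRrM.
by rewrite gt0_ltr_powR ?nnegrE ?powR_ge0.
Unshelve. all: by end_near. Qed.

(** Provides the upper bound for dominated convergence. Convexity of the [p]-th power comes from two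
    tangent inequalities at the same point [m]. *)
Lemma powR_norm_quotient_le (R : realType) (V : normedModType R) (p s : R) (x y : V) :
  1 < p -> 0 < s <= 1 ->
  (`|x + s *: y| `^ p - `|x| `^ p) / s <= `|x + y| `^ p - `|x| `^ p.
Proof.
move=> p1 /andP[s0 s1]; rewrite ler_pdivrMr//.
set a := `|x|; set b := `|x + y|; pose m := (1 - s) * a + s * b.
have s10 : 0 <= 1 - s by rewrite subr_ge0.
have m0 : 0 <= m by rewrite addr_ge0// mulr_ge0 ?normr_ge0// ltW.
have xm : `|x + s *: y| <= m.
  have -> : x + s *: y = (1 - s) *: x + s *: (x + y).
    by rewrite scalerDr addrA -scalerDl subrK scale1r.
  by rewrite (le_trans (ler_normD _ _))// !normrZ !ger0_norm// ltW.
have xmp : `|x + s *: y| `^ p <= m `^ p.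
  by rewrite ge0_ler_powR ?nnegrE// ltW// (lt_trans ltr01).
have am := powR_tangent p1 m0 (normr_ge0 x).
have bm := powR_tangent p1 m0 (normr_ge0 (x + y)).
have := lerD (ler_wpM2l s10 am) (ler_wpM2l (ltW s0) bm).
rewrite -/a -/b; move: (m `^ (p - 1)) => mp.
(* By the choice of [m], the weights [1 - s] and [s] cancel the linear terms. *)
rewrite [leLHS](_ : _ = 0); last by rewrite /m; ring.
lra.
Qed.

Section DualityMapping.
Context {R : realType} (V : normedModType R) (p : R) (p1 : 1 < p).
Implicit Types (x y : V) (j : dual V).

Lemma duality_mapping_scaled j x : x != 0 -> duality_mapping p x j ->
  exists f : dual V, [/\ `|f| = 1, f x = `|x| & j = `|x| `^ (p - 1) *: f].
Proof.
move=> x0 [jx jn]; exists ((`|x| `^ (p - 1))^-1 *: j).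
have xp : 0 < `|x| `^ (p - 1) by rewrite powR_gt0 ?normr_gt0.
split.
- by rewrite normrZ normfV -jn normr_id mulVf// jn gt_eqF.
- by rewrite dualZE jx jn mulrCA mulVf ?mulr1 ?gt_eqF.
- by rewrite scalerA divff ?scale1r ?gt_eqF.
Qed.

Lemma duality_mapping_at0 j : duality_mapping p 0 j -> j = 0.
Proof.
move=> [_]; rewrite normr0 powR0; last by rewrite subr_eq0 gt_eqF.
exact: normr0_eq0.
Qed.

(** Since [j] attains its norm at [x], [j y] is at most the norm of [j] times the increment of the
    norm; the tangent inequality concludes. Valid in any normed space, it is also applied in the
    Bochner space itself. *)
Lemma duality_mapping_subgradient j x y : duality_mapping p x j ->
  p * j y <= `|x + y| `^ p - `|x| `^ p.
Proof.
move=> [jx jn]; apply: le_trans (powR_tangent p1 (normr_ge0 _) (normr_ge0 _)).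
rewrite -mulrA ler_pM2l ?(lt_trans ltr01)// -jn mulrBr.
rewrite [_ * `|x|]mulrC -jx lerBrDr -raddfD addrC.
by rewrite (le_trans (ler_norm _))// dual_norm_bound.
Qed.

(** The subgradient inequality bounds the quotients below; the tangent inequality at
    [x + harmonic n *: y] bounds them above by [U]. Steps along a sequence suit measurability of
    limits and dominated convergence. *)
Lemma duality_mapping_derivative j x y : smooth_norm V -> duality_mapping p x j ->
  (fun n => (`|x + harmonic n *: y| `^ p - `|x| `^ p) / harmonic n) @ \oo -->
  p * j y.
Proof.
move=> smoothV xj.
have p10 : 0 < p - 1 by rewrite subr_gt0.
have cx : (fun n => x + harmonic n *: y) @ \oo --> x.
  rewrite -[X in _ --> X]addr0 -[X in _ --> _ + X](scale0r y).
  by apply: cvgD; [exact: cvg_cst|apply: cvgZr_tmp; exact: cvg_harmonic].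
have cpow : (fun n => `|x + harmonic n *: y| `^ (p - 1)) @ \oo -->
    `|x| `^ (p - 1).
  by apply: cvg_powR => //; exact: cvg_norm.
pose U n := p * `|x + harmonic n *: y| `^ (p - 1) *
  ((`|x + harmonic n *: y| - `|x|) / harmonic n).
have cU : U @ \oo --> p * j y.
  have [x0|x0] := eqVneq x 0.
    (* At 0 the quotient of the norm is constant, while the factor with exponent [p - 1 > 0] tends
       to 0. *)
    move: xj cpow; rewrite /U x0 => /duality_mapping_at0 -> cpow.
    rewrite [_ y]/(0 : R) mulr0 -(mul0r `|y|).
    rewrite [X in X @ _ --> _](_ : _ = (fun n =>
      p * `|0 + harmonic n *: y| `^ (p - 1) * `|y|)); last first.
      apply/funext => n; congr (_ * _); rewrite normr0 subr0 add0r normrZ.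
      by rewrite (gtr0_norm (harmonic_gt0 n)) mulrC mulKf ?gt_eqF ?harmonic_gt0.
    apply: cvgMr_tmp; rewrite -(mulr0 p); apply: cvgMl_tmp.
    by move: cpow; rewrite normr0 powR0// gt_eqF.
  have [f [f1 fx ->]] := duality_mapping_scaled x0 xj.
  rewrite dualZE mulrA; apply: cvgM; last exact: smooth_norm_derivative.
  exact: cvgMl_tmp.
apply: (squeeze_cvgr _ (cvg_cst (p * j y)) cU).
apply: nearW => n; have h0 : 0 < harmonic n :> R := harmonic_gt0 n.
apply/andP; split.
  rewrite ler_pdivlMr//; have := duality_mapping_subgradient (harmonic n *: y) xj.
  by rewrite linearZ /= mulrA mulrAC.
rewrite /U ler_pdivrMr// -[leRHS]mulrA divfK ?gt_eqF//.
have := powR_tangent p1 (normr_ge0 (x + harmonic n *: y)) (normr_ge0 x).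
lra.
Qed.

End DualityMapping.

(** * Existence of duality functionals and change of exponent *)

Section DualityMappingScaling.
Context {R : realType} (V : normedModType R).
Implicit Types (x : V) (f : dual V).

(** Hahn-Banach with the norm as sublinear bound gives a support functional, which is then
    rescaled. *)
Lemma duality_mapping_nonempty (p : R) x : 1 < p -> duality_mapping p x !=set0.
Proof.
move=> p1.
have [f [fV fx f1]] : exists f : dual V,
    [/\ forall y, f y <= `|y|, f x = `|x| & `|f| <= 1].
  apply: dual_hahn_banach => //; split; first exact: ler_normD.
  by move=> a y a0; rewrite normrZ gtr0_norm.
have [x0|x0] := eqVneq x 0.
  exists 0; rewrite x0; split; first by rewrite linear0 normr0 mul0r.
  by rewrite !normr0 powR0// subr_eq0 gt_eqF.
have fn : `|f| = 1.
  apply/le_anti; rewrite f1/=.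
  have := dual_norm_bound f x; rewrite fx normr_id.
  by rewrite -[leLHS]mul1r ler_pM2r ?normr_gt0.
have fc : `| `|x| `^ (p - 1) *: f| = `|x| `^ (p - 1).
  by rewrite normrZ fn mulr1 ger0_norm ?powR_ge0.
exists (`|x| `^ (p - 1) *: f); split => //.
by rewrite dualZE fx fc mulrC.
Qed.

(** If [x != 0], rescaling corrects the norm and keeps the alignment with [x]. If [x = 0], the
    hypothesis forces [p <= q], and both sets contain only the zero functional, whatever the
    scalar. *)
Lemma duality_mapping_rescale (p q : R) x f : 1 < p -> 1 <= q ->
  (q < p -> x != 0) ->
  duality_mapping q x f <->
  exists2 g, duality_mapping p x g & f = `|x| `^ (q - p) *: g.
Proof.
move=> p1 q1 x0.
have [xE|xN0] := eqVneq x 0.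
  have pq : p <= q by rewrite leNgt; apply/negP => /x0; rewrite xE eqxx.
  have q1' := lt_le_trans p1 pq.
  rewrite xE; split=> [/(duality_mapping_at0 q1') ->|[g /(duality_mapping_at0 p1) -> ->]].
    have [g g0] := duality_mapping_nonempty (0 : V) p1.
    by exists g => //; rewrite (duality_mapping_at0 p1 g0) scaler0.
  have [h h0] := duality_mapping_nonempty (0 : V) q1'.
  by rewrite scaler0 -(duality_mapping_at0 q1' h0).
have nx : 0 < `|x| by rewrite normr_gt0.
have powD r s : `|x| `^ r * `|x| `^ s = `|x| `^ (r + s).
  by rewrite powRD// (gt_eqF nx) implybT.
have scaled r s g : duality_mapping r x g ->
    duality_mapping s x (`|x| `^ (s - r) *: g).
  move=> [gx gn]; have sn : `| `|x| `^ (s - r) *: g| = `|x| `^ (s - 1).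
    by rewrite normrZ ger0_norm ?powR_ge0// gn powD addrA subrK.
  by split; rewrite // dualZE gx sn mulrCA gn powD addrA subrK.
split=> [xf|[g /scaled xg ->]//].
exists (`|x| `^ (p - q) *: f); first exact: scaled.
by rewrite scalerA powD addrA subrK subrr powRr0 scale1r.
Qed.

End DualityMappingScaling.

(** * Strong measurability of the duality mapping *)

Section SeparableRange.
Context {R : realType} (W : normedModType R).

Lemma countable_sub_range (A : set W) : countable A ->
  exists u : nat -> W, A `<=` range u.
Proof.
have [->|A0] := eqVneq A set0; first by exists (fun=> 0).
by move=> /pcard_geP/unsquash f; exists f; exact: (@surj _ _ _ _ f).
Qed.

(** With lists, indices may repeat, sums are concatenations, and rational combinations are
    enumerated by [unpickle]. *)
Definition combination (e : nat -> W) (l : seq (R * nat)) : W :=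
  \sum_(x <- l) x.1 *: e x.2.

Lemma rat_combination_dense (e : nat -> W) : exists D : nat -> W,
  forall l eps, 0 < eps -> exists n, `|combination e l - D n| < eps.
Proof.
pose C (l : seq (rat * nat)) := combination e [seq (ratr x.1, x.2) | x <- l].
exists (fun n => if unpickle n is Some l then C l else 0) => l eps eps0.
suff [l' ll'] : exists l', `|combination e l - C l'| < eps.
  by exists (pickle l'); rewrite pickleK.
elim: l eps eps0 => [|[a i] l IHl] eps eps0.
  by exists [::]; rewrite /C/= subrr normr0.
have e20 : 0 < eps / 2 by rewrite divr_gt0.
have [l' ll'] := IHl _ e20.
have c0 : 0 < 1 + `|e i| by rewrite ltr_wpDr.
have : a < a + eps / 2 / (1 + `|e i|) by rewrite ltrDl divr_gt0.
move=> /rat_in_itvoo[q]; rewrite in_itv/= => /andP[aq qa].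
exists ((q, i) :: l'); rewrite /C/= /combination !big_cons/=.
rewrite opprD addrACA -scalerBl -/(combination _ _) -/(combination _ _) -/(C l').
rewrite (le_lt_trans (ler_normD _ _))// [ltRHS](splitr eps) ltr_leD//; last exact: ltW.
rewrite normrZ distrC gtr0_norm ?subr_gt0//.
have : ratr q - a < eps / 2 / (1 + `|e i|) by rewrite ltrBlDl.
rewrite ltr_pdivlMr//; apply: le_lt_trans.
by rewrite mulrDr mulr1 lerDr subr_ge0 ltW.
Qed.

(* Hahn-Banach for the distance to the span of [e], which is sublinear. *)
Lemma annihilator_combination_dense (e : nat -> W) (w : W) :
  (forall F : dual W, (forall i, F (e i) = 0) -> F w = 0) ->
  forall eps, 0 < eps -> exists l, `|w - combination e l| < eps.
Proof.
move=> ann eps eps0.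
pose q x := inf (range (fun l => `|x - combination e l|)).
have lq x : has_lbound (range (fun l => `|x - combination e l|)).
  by exists 0 => _ [l _ <-].
have sq : sublinear q.
  apply: (sublinear_inf [::] (F := fun l x => `|x - combination e l|)) => //.
    move=> l m x y; exists (l ++ m).
    by rewrite /combination big_cat/= opprD addrACA ler_normD.
  move=> l a x a0; exists [seq (a * z.1, z.2) | z <- l].
  rewrite /combination big_map/=.
  under eq_bigr do rewrite -scalerA.
  by rewrite -scaler_sumr -scalerBr normrZ gtr0_norm.
have q1 x : q x <= `|x|.
  by have := ge_inf_range [::] (lq x); rewrite /combination big_nil subr0.
have [F [Fq Fw _]] := dual_hahn_banach w sq q1.
have qe a i : q (a *: e i) <= 0.
  have := ge_inf_range [:: (a, i)] (lq (a *: e i)).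
  by rewrite /combination big_seq1 subrr normr0.
(* [F] lies below [q], which is nonpositive at both [e i] and [- e i]. *)
have Fe i : F (e i) = 0.
  apply/le_anti; rewrite -[X in _ <= X <= _]mul1r; apply/andP; split.
    by rewrite mul1r -[e i]scale1r (le_trans (Fq _)).
  rewrite mul1r -oppr_le0 -linearN -scaleN1r (le_trans (Fq _))//.
have [|_ [l _ <-]] := @inf_adherent _ _ _ eps0 (conj _ (lq w)).
  by exists `|w - combination e [::]|, [::].
by rewrite -/(q w) -Fw (ann F Fe) add0r; exists l.
Qed.

End SeparableRange.

Section StronglyMeasurable.
Context d (T : measurableType d) {R : realType}.

(** Measurable distances make the set where a new [D n] is strictly closer measurable, so the
    closest-point functions are simple. *)
Lemma strongly_measurable_approx (W : normedModType R) (g : T -> W) (D : nat -> W) :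
  (forall t eps, 0 < eps -> exists n, `|g t - D n| < eps) ->
  (forall n, measurable_fun setT (fun t => `|g t - D n|)) ->
  strongly_measurable g.
Proof.
move=> gD mg.
(* the closest point to [g t] among [D 0, ..., D n] *)
pose s := fix s n t := if n is m.+1 then
  (if `|g t - D n| < `|g t - s m t| then D n else s m t) else D 0.
have ms n : simple_fun (s n) /\ measurable_fun setT (fun t => `|g t - s n t|).
  elim: n => [|n [sn mn]].
    split; last exact: mg.
    split; first exact: finite_image_cst.
    move=> w; rewrite preimage_cst.
    by case: ifP => _; [exact: measurableT|exact: measurable0].
  have mb : measurable_fun setT (fun t => `|g t - D n.+1| < `|g t - s n t|).
    exact: measurable_fun_ltr.
  split.
    apply: (simple_fun_comp2 (fun (b : bool) w => if b then D n.+1 else w)) => //.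
    split=> [|b]; first exact: finite_finset.
    by rewrite -[X in measurable X]setTI; exact: mb.
  rewrite (_ : (fun t => _) = (fun t => if `|g t - D n.+1| < `|g t - s n t| then
    `|g t - D n.+1| else `|g t - s n t|)).
    apply: measurable_fun_ifT => //.
  by apply/funext => t /=; case: ifPn.
exists s; split=> [n|t]; first by have [] := ms n.
have sD k n : (k <= n)%N -> `|g t - s n t| <= `|g t - D k|.
  elim: n => [|n IHn]; first by rewrite leqn0 => /eqP ->.
  rewrite leq_eqVlt => /orP[/eqP ->|/IHn h] /=.
    by case: ifPn => //; rewrite -leNgt.
  by case: ifPn => // h1; rewrite (le_trans (ltW h1)).
apply/cvgrPdist_lt => e e0; have [k gk] := gD t e e0.
by exists k => // n kn; rewrite (le_lt_trans (sD k n kn)).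
Qed.

Lemma dual_norm_approx (V : normedModType R) (f : dual V) (e : R) : 0 < e ->
  exists x : V, `|x| <= 1 /\ `|f| - e < `|f x|.
Proof.
move=> e0; have [|_ [x /= x1 <-] fx] :=
  @sup_adherent _ [set `|f x| | x in [set x : V | `|x| <= 1]] e e0.
  split; first by exists `|f 0|, 0; rewrite //= normr0.
  exists `|f| => _ [x /= x1 <-].
  by rewrite (le_trans (dual_norm_bound _ _))// ler_piMr.
by exists x; split.
Qed.

(* If [D] is dense in the range of [g], countably many vectors which almost norm
   the differences [D m - D n] norm all the functionals [g t - D n], whose norms
   are thus measurable. *)
Lemma weak_strongly_measurable (V : normedModType R) (g : T -> dual V)
    (D : nat -> dual V) :
  (forall t eps, 0 < eps -> exists n, `|g t - D n| < eps) ->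
  (forall x, measurable_fun setT (fun t => g t x : R)) ->
  strongly_measurable g.
Proof.
move=> gD mg; apply: (strongly_measurable_approx gD) => n.
have /choice[x xP] : forall mk : nat * nat, exists x : V,
    `|x| <= 1 /\ `|D mk.1 - D n| - harmonic mk.2 < `|(D mk.1 - D n) x|.
  by move=> [m k]; apply: dual_norm_approx; exact: harmonic_gt0.
move=> mT; apply: (measurability _ (RGenOInfty.measurableE R)) => //.
move=> _ [_ [r ->] <-]; rewrite setTI.
rewrite (_ : _ @^-1` _ = \bigcup_m \bigcup_k
  ((fun t => `|(g t - D n) (x (m, k))|) @^-1` `]r, +oo[%classic)); last first.
  apply/seteqP; split=> t /=.
    rewrite in_itv/= andbT => rt.
    (* A third of the gap for each of three errors: replacing [g t] by [D m] in the norm, the defect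
       of [x (m, k)], and returning from [D m] to [g t] at that vector. *)
    pose e := (`|g t - D n| - r) / 3.
    have e0 : 0 < e by rewrite divr_gt0// subr_gt0.
    have [m gm] := gD t e e0.
    have [k _ ke] := cvgr_lt _ cvg_harmonic _ e0.
    exists m => //; exists k => //=; rewrite in_itv/= andbT.
    have [x1 xk] := xP (m, k).
    have Nab := ler_distD (D m) (g t) (D n).
    have cA : `|(D m - D n) (x (m, k))| <= `|(g t - D n) (x (m, k))| +
        `|g t - D m|.
      have -> : D m - D n = (g t - D n) + (D m - g t).
        by rewrite [RHS]addrC addrA subrK.
      rewrite dualDE (le_trans (ler_normD _ _))// lerD2l.
      by rewrite (le_trans (dual_norm_bound _ _))// distrC ler_piMr.
    have arith (N a b c h A e' : R) : b - h < c -> a < e' -> h < e' ->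
        3 * e' = N - r -> N <= a + b -> c <= A + a -> r < A.
      by clear; lra.
    apply: (arith _ _ _ _ _ _ _ xk gm (ke k (leqnn k)) _ Nab cA).
    by rewrite /e mulrC divfK.
  move=> [m _ [k _ /=]]; rewrite !in_itv/= !andbT => rx.
  apply: (lt_le_trans rx).
  have [x1 _] := xP (m, k).
  have h := dual_norm_bound (g t - D n) (x (m, k)).
  exact: (le_trans h (ler_piMr (normr_ge0 _) x1)).
apply: bigcupT_measurable => m; apply: bigcupT_measurable => k.
rewrite -[X in measurable X]setTI.
suff : measurable_fun setT (fun t => `|(g t - D n) (x (m, k))|).
  by apply => //; exact: measurable_itv.
apply: measurableT_comp => //.
exact: (measurable_funB (mg _) (measurable_cst _)).
Qed.

End StronglyMeasurable.

Section DualitySelection.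
Context {R : realType} (V : normedModType R) (p : R) (p1 : 1 < p).
Hypothesis smoothV : smooth_norm V.
Variables (j : V -> dual V) (jP : forall x, duality_mapping p x (j x)).

(** If [j (u n)] vanishes at [z], the subgradient inequality shows that moving from [u n] along [z]
    does not decrease the norm. This passes to the limit [x], so the derivative there along [z] is
    nonnegative; take [z] to be [y] and [- y]. *)
Lemma duality_selection_annihilator (u : nat -> V) (x y : V) :
  u @ \oo --> x -> (forall n, j (u n) y = 0) -> j x y = 0.
Proof.
move=> ux u0; have p0 : 0 < p by rewrite (lt_trans ltr01).
suff jz0 z : (forall n, j (u n) z = 0) -> 0 <= j x z.
  apply/le_anti; rewrite jz0// andbT -oppr_ge0 -linearN jz0// => n.
  by rewrite linearN /= u0 oppr0.
move=> uz; rewrite -(pmulr_rge0 _ p0).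
apply: (cvgr_to_ge (duality_mapping_derivative (y := z) p1 smoothV (jP x))).
apply: nearW => k; rewrite divr_ge0 ?harmonic_ge0// subr_ge0.
have cu : (fun n => `|u n| `^ p) @ \oo --> `|x| `^ p.
  by apply: cvg_powR => //; exact: cvg_norm.
have cuz : (fun n => `|u n + harmonic k *: z| `^ p) @ \oo -->
    `|x + harmonic k *: z| `^ p.
  apply: cvg_powR => //; apply: cvg_norm; apply: cvgD => //; exact: cvg_cst.
apply: (ler_cvg_to cu cuz); apply: nearW => n.
have := duality_mapping_subgradient p1 (harmonic k *: z) (jP (u n)).
by rewrite linearZ /= uz scaler0 mulr0 subr_ge0.
Qed.

Context d (T : measurableType d).

Lemma duality_selection_measurable (f : T -> V) (y : V) :
  strongly_measurable f -> measurable_fun setT (fun t => j (f t) y : R).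
Proof.
move=> mf; have p0 : p != 0 by rewrite gt_eqF// (lt_trans ltr01).
rewrite (_ : (fun t => _) = (fun t => p^-1 * (p * j (f t) y))); last first.
  by apply/funext => t; rewrite mulKf.
apply: measurable_funM; first exact: measurable_cst.
apply: (@measurable_fun_cvg _ _ _ _
  (fun n t => (`|f t + harmonic n *: y| `^ p - `|f t| `^ p) / harmonic n)); last first.
  by move=> t _; exact: duality_mapping_derivative.
move=> n; apply: measurable_funM; last exact: measurable_cst.
apply: measurable_funB; apply: (measurableT_comp (measurable_powR p)).
  apply: strongly_measurable_norm.
  exact: (strongly_measurableD mf (strongly_measurable_cst _ _)).
exact: strongly_measurable_norm.
Qed.

Lemma reflexive_duality_selection_separable (f : T -> V) :
  reflexive_space V -> strongly_measurable f -> exists D : nat -> dual V,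
    forall t eps, 0 < eps -> exists n, `|j (f t) - D n| < eps.
Proof.
move=> reflV [s [ss sf]].
(* [u] runs through the values of all the simple functions approximating [f]. *)
have [|u uP] := @countable_sub_range _ _ (\bigcup_n range (s n)).
  apply: bigcup_countable => // n _; apply: finite_set_countable.
  by have [] := ss n.
have [D DP] := rat_combination_dense (fun n => j (u n)).
exists D => t eps eps0; have e20 : 0 < eps / 2 by rewrite divr_gt0.
have [F F0|l jl] :=
  @annihilator_combination_dense _ _ (fun n => j (u n)) (j (f t)) _ _ e20.
  have [y Fy] := reflV F; rewrite Fy.
  apply: (duality_selection_annihilator (sf t)) => n.
  have [m _ <-] : range u (s n t) by apply: uP; exists n => //; exists t.
  by rewrite -Fy F0.
have [n ln] := DP l _ e20; exists n.
rewrite (le_lt_trans (ler_distD (combination (fun n => j (u n)) l) _ _))//.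
by rewrite [ltRHS](splitr eps) ltrD.
Qed.

Lemma separable_space_seq : separable_space (dual V) ->
  exists D : nat -> dual V, forall f eps, 0 < eps -> exists n, `|f - D n| < eps.
Proof.
move=> [A cA dA]; have [u uP] := countable_sub_range cA.
exists u => f eps eps0.
have [|g [fg /uP[n _ ug]]] := dA (ball f eps) _ (ball_open f eps).
  by exists f; exact: ballxx.
by exists n; rewrite ug; move: fg; rewrite -ball_normE.
Qed.

Lemma strongly_measurable_duality_selection (f : T -> V) :
  reflexive_space V \/ separable_space (dual V) -> strongly_measurable f ->
  strongly_measurable (j \o f).
Proof.
move=> sepV mf.
have [D DP] : exists D : nat -> dual V,
    forall t eps, 0 < eps -> exists n, `|j (f t) - D n| < eps.
  have [reflV|/separable_space_seq[D DP]] := sepV.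
    exact: reflexive_duality_selection_separable.
  by exists D => t; exact: DP.
apply: (weak_strongly_measurable DP) => y.
exact: duality_selection_measurable.
Qed.

End DualitySelection.

(** * Lebesgue-Bochner spaces *)

Section BochnerDuality.
Context d (T : measurableType d) (R : realType) (mu : {measure set T -> \bar R}).
Variable V : normedModType R.

Section Power.
Variables (p : R) (p1 : 1 <= p).
Implicit Type u : Bochner mu p1 V.

Lemma measurable_Bochner_powR u : measurable_fun setT (fun t => `|u t| `^ p).
Proof.
apply: (measurableT_comp (measurable_powR p)).
exact/strongly_measurable_norm/Bochner_strongly_measurable.
Qed.

Lemma integral_Bochner_powR u :
  (\int[mu]_t (`|u t| `^ p)%:E = (`|u| `^ p)%:E)%E.
Proof.
have p0 : p != 0 by rewrite gt_eqF// (lt_le_trans ltr01).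
rewrite -poweR_EFin Bochner_space_normE fineK ?Bochner_norm_fin_num//.
rewrite /Bochner_norm (powR_Lnorm _ _ p0); apply: eq_integral => t _.
by rewrite /= normr_id.
Qed.

Lemma integrable_Bochner_powR u : mu.-integrable setT (fun t => (`|u t| `^ p)%:E).
Proof.
apply/integrableP; split; first exact/measurable_EFinP/measurable_Bochner_powR.
under eq_integral do rewrite gee0_abs ?lee_fin ?powR_ge0//.
by rewrite integral_Bochner_powR ltry.
Qed.

End Power.

Variables (p p' : R) (p1 : 1 < p) (pp' : p^-1 + p'^-1 = 1).
Let le1p := ltW p1.
Let le1p' := conjugate_exponent_ge1 p1 pp'.

Lemma conjugate_exponentE : (p - 1) * p' = p.
Proof.
have p0 : p != 0 by rewrite gt_eqF// (lt_trans ltr01).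
have p'0 : p' != 0 by rewrite gt_eqF// (lt_le_trans ltr01).
have pp'E : p' + p = p * p' by rewrite -[RHS]mulr1 -pp'; field; rewrite p0 p'0.
by rewrite mulrBl mul1r -pp'E addrAC subrr add0r.
Qed.

(** As [(p - 1) * p' = p], the [p']-th power of the norm of [j (u t)] is the [p]-th power of the
    norm of [u t], which has finite integral. *)
Lemma Bochner_duality_selection (j : V -> dual V) (u : Bochner mu le1p V) :
  (forall x, duality_mapping p x (j x)) -> strongly_measurable (j \o u) ->
  exists J : Bochner mu le1p' (dual V), {ae mu, forall t, J t = j (u t)}.
Proof.
move=> jP mj; have p'0 : 0 < p' by rewrite (lt_le_trans ltr01).
suff jL : (j \o u) \in Bochner_pred mu le1p' (V := dual V).
  by exists (Bochner_class (BochnerFun jL)); exact: Bochner_reprK.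
rewrite inE; split => //; apply: (@lty_poweRy _ _ p'); first by rewrite gt_eqF.
rewrite powR_Lnorm ?gt_eqF//.
rewrite (eq_integral (fun t => (`|u t| `^ p)%:E)); last first.
  move=> t _ /=; have [_ ->] := jP (u t).
  by rewrite ?poweR_EFin ger0_norm ?powR_ge0// -powRrM conjugate_exponentE.
by rewrite integral_Bochner_powR ltry.
Qed.

Lemma Bochner_pairingZ (c : R) (J : Bochner mu le1p' (dual V)) :
  Bochner_pairing pp' (c *: J : Bochner mu le1p' (dual V)) =
  c *: Bochner_pairing pp' J :> dual (Bochner mu le1p V).
Proof.
apply: dual_eqP => v; rewrite dualZE !Bochner_pairingE -RintegralZl//; last first.
  exact: integrable_pairing.
rewrite /Rintegral; congr fine; apply: ae_eq_integral => //.
- apply/measurable_EFinP/strongly_measurable_pairing; exact: Bochner_strongly_measurable.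
- apply/measurable_EFinP/measurable_funM => //.
  apply: strongly_measurable_pairing; exact: Bochner_strongly_measurable.
- by apply: filterS (BochnerZE c J) => t -> _.
Qed.

Hypothesis smoothV : smooth_norm V.
Variables (u : Bochner mu le1p V) (J : Bochner mu le1p' (dual V)).
Hypothesis uJ : {ae mu, forall t, duality_mapping p (u t) (J t)}.

(* Dominated convergence: the quotients of [`|.| `^ p] at [u t] in the direction
   [v t] increase with the step, and are bounded below by
   [`|u t| `^ p - `|u t - v t| `^ p] and above by the quotient for the step 1. *)
Lemma Bochner_powR_derivative (v : Bochner mu le1p V) :
  (fun n => (`|u + harmonic n *: v| `^ p - `|u| `^ p) / harmonic n) @ \oo -->
  p * Bochner_pairing pp' J v.
Proof.
have p0 : 0 < p by rewrite (lt_trans ltr01).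
pose F n t :=
  (`|(u + harmonic n *: v : Bochner mu le1p V) t| `^ p - `|u t| `^ p) / harmonic n.
have h1 n : 0 < (harmonic n : R) <= 1.
  by rewrite harmonic_gt0/= invf_le1// ler1n.
have ifun (w : Bochner mu le1p V) := integrable_Bochner_powR w.
have mw (w : Bochner mu le1p V) := measurable_Bochner_powR w.
(* Operations on classes are pointwise only almost everywhere; the countably many steps share one
   null set. *)
have uhv : {ae mu, forall t n, (u + harmonic n *: v : Bochner mu le1p V) t =
    u t + harmonic n *: v t}.
  apply: ae_foralln => n; apply: filterS2 (BochnerDE u (harmonic n *: v))
    (BochnerZE (harmonic n) v) => t -> ->//.
have FE n : (\int[mu]_t (F n t)%:E =
    ((`|u + harmonic n *: v| `^ p - `|u| `^ p) / harmonic n)%:E)%E.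
  rewrite /F; under eq_integral do rewrite mulrC EFinM EFinB.
  rewrite integralZl//; last exact: integrableB.
  by rewrite integralB// !integral_Bochner_powR mulrC EFinM EFinB.
have ipair := integrable_pairing pp' J v.
have ifin : (\int[mu]_t (p * (J t (v t) : R))%:E)%E \is a fin_num.
  by apply: integrable_fin_num => //; exact: (integrableZl measurableT p ipair).
rewrite Bochner_pairingE -RintegralZl//.
have [] := @dominated_convergence _ _ _ mu setT measurableT
  (fun n t => (F n t)%:E) (fun t => (p * (J t (v t) : R))%:E)
  (fun t => (`|(u + v : Bochner mu le1p V) t| `^ p +
             `|(u - v : Bochner mu le1p V) t| `^ p)%:E).
- move=> n; apply/measurable_EFinP; apply: measurable_funM => //.
  exact: measurable_funB.
- apply/measurable_EFinP; apply: measurable_funM => //.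
  by apply: strongly_measurable_pairing; exact: Bochner_strongly_measurable.
- apply: filterS2 uhv uJ => t ut Jt _; apply: cvg_EFin; first exact: nearW.
  rewrite /F /comp /=; under eq_fun do rewrite ut.
  exact: duality_mapping_derivative.
- exact: (integrableD measurableT (ifun (u + v)) (ifun (u - v))).
- have uvE : {ae mu, forall t, (u - v : Bochner mu le1p V) t = u t - v t}.
    rewrite -scaleN1r; apply: filterS2 (BochnerDE u (-1 *: v)) (BochnerZE (-1) v).
    by move=> t -> ->; rewrite scaleN1r.
  apply: filter_app uvE; apply: filter_app (BochnerDE u v).
  apply: filterS2 uhv uJ => t ut Jt uv uNv n _.
  rewrite uv uNv lee_fin /F ut ler_norml.
  have hn := h1 n; have /andP[h0 _] := hn.
  have := powR_norm_quotient_le (u t) (v t) p1 hn.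
  have lo : p * J t (v t) <= (`|u t + harmonic n *: v t| `^ p - `|u t| `^ p) / harmonic n.
    rewrite ler_pdivlMr//.
    have := duality_mapping_subgradient p1 (harmonic n *: v t) Jt.
    by rewrite linearZ /= mulrA mulrAC.
  have := duality_mapping_subgradient p1 (- v t) Jt; rewrite linearN /= mulrN.
  have := powR_ge0 `|u t| p; have := powR_ge0 `|u t + v t| p.
  have := powR_ge0 `|u t - v t| p.
  move: lo; set A := _ / _; set B := _ * _; lra.
move=> _ _; rewrite /=; under eq_fun do rewrite FE.
by rewrite -(fineK ifin) => /fine_cvg.
Qed.

(** Hahn-Banach supplies an element [f]. As [p] times [f] is a subgradient, [f v] is at most the
    value of the pairing at [v], and [- v] gives equality. Membership of the pairing follows from
    this uniqueness, without computing its norm. *)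
Lemma Bochner_duality_mapping : duality_mapping p u = [set Bochner_pairing pp' J].
Proof.
suff uniq (f : dual (Bochner mu le1p V)) : duality_mapping p u f ->
    f = Bochner_pairing pp' J.
  have [f uf] := duality_mapping_nonempty u p1.
  apply/seteqP; split=> [g /uniq //|_ ->].
  by rewrite -(uniq f uf).
move=> uf; have p0 : 0 < p by rewrite (lt_trans ltr01).
have le (v : Bochner mu le1p V) : f v <= Bochner_pairing pp' J v.
  rewrite -(ler_pM2l p0); apply: (cvgr_to_ge (Bochner_powR_derivative (v := v))).
  apply: nearW => n; rewrite ler_pdivlMr ?harmonic_gt0//.
  have := duality_mapping_subgradient p1 (harmonic n *: v) uf.
  by rewrite linearZ /= mulrA mulrAC.
apply: dual_eqP => v; apply/le_anti; rewrite le/=.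
by have := le (- v); rewrite !linearN /= lerN2.
Qed.

End BochnerDuality.

(** The restricted measure of [N] is the Lebesgue measure of its part in [0, T], so that part is
    Lebesgue null. *)
Lemma ae_lebesgue_on (R : realType) (T : R) (P : R -> Prop) :
  {ae lebesgue_on T, forall t, P t} ->
  {ae lebesgue_measure, forall t, t \in `[0, T] -> P t}.
Proof.
move=> [N [mN N0 PN]]; exists (N `&` `[0, T]); split => //.
  by apply: measurableI => //; exact: measurable_itv.
by move=> t /= /not_implyP[tT Pt]; split => //; exact: PN.
Qed.

Theorem theorem2p8 (R : realType) (X : completeNormedModType R)
    (p p' q T : R) (p1 : 1 < p) (pp' : p^-1 + p'^-1 = 1) (q1 : 1 <= q)
    (T0 : 0 < T) (smoothX : smooth_norm X)
    (reflX : reflexive_space X \/ separable_space (dual X))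
    (jX : X -> dual X) (jXP : forall x : X, duality_mapping p x (jX x))
    (theta : Bochner (lebesgue_on T) (ltW p1) X)
    (theta0 : q < p -> theta != 0) :
  exists g : Bochner (lebesgue_on T) (conjugate_exponent_ge1 p1 pp') (dual X),
    {ae lebesgue_measure, forall t : R, t \in `[0, T] ->
       g t = `|theta| `^ (q - p) *: jX (theta t)} /\
    duality_mapping q theta = [set Bochner_pairing pp' g].
Proof.
have mj := strongly_measurable_duality_selection p1 smoothX jXP reflX
  (Bochner_strongly_measurable theta).
have [J Jj] := Bochner_duality_selection pp' jXP mj.
have thetaJ : {ae lebesgue_on T, forall t, duality_mapping p (theta t) (J t)}.
  by apply: filterS Jj => t ->.
have pJ := Bochner_duality_mapping smoothX thetaJ.
pose c := `|theta| `^ (q - p).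
(* [J] settles the exponent [p]; passing to [q] in the Bochner space multiplies by [c], which the
   pairing carries through. *)
exists (c *: J); split.
  apply: ae_lebesgue_on; apply: filterS2 Jj (BochnerZE c J) => t -> ->//.
rewrite Bochner_pairingZ.
apply/seteqP; split=> [f /(duality_mapping_rescale f p1 q1 theta0)[g + ->]|_ ->].
  by rewrite pJ => ->.
apply/(duality_mapping_rescale _ p1 q1 theta0).
by exists (Bochner_pairing pp' J) => //; rewrite pJ.
Qed.
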